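(* Let $d\geq 1$ be an integer, let $X$ be a compact metric space and let $f:X\to X$ be a continuous map which is MMA and MQDS$(d)$. Let ${\bf c}=(c_n)_{n\in\mathbb{N}}$ be any oscillating sequence of order $d$. Then ${\bf c}$ and $f$ are linearly disjoint; that is, for every continuous function $\phi:X\to\mathbb{C}$ and every $x\in X$, $$\lim_{N\to\infty}\frac1N\sum_{n=1}^N c_n\,\phi(f^n x)=0.$$
   Context: $\mathbb{N}=\{1,2,\dots\}$; $f^n$ denotes the $n$-fold composition of $f$ and $f^0$ is the identity; $d(\cdot,\cdot)$ denotes the metric of $X$; $C(K)$ is the space of continuous complex-valued functions on $K$ with the maximum norm. Standing assumptions on sequences: every sequence ${\bf c}=(c_n)_{n\in\mathbb{N}}$ of complex numbers considered satisfies $\lim_{N\to\infty}\frac1N\sum_{n=1}^N c_n=0$, and there are constants $C>0$ and $\lambda>1$ such that $\frac1N\sum_{n=1}^N|c_n|^\lambda\leq C$ for all $N\geq 1$. Oscillating sequences: ${\bf c}$ is an oscillating sequence (order $1$) if $\lim_{N\to\infty}\frac1N\sum_{n=1}^N c_n e^{2\pi i n\theta}=0$ for every $0\leq\theta<1$. For $d\geq 2$, ${\bf c}$ is an oscillating sequence of order $d$ if $\lim_{N\to\infty}\frac1N\sum_{n=1}^N c_n e^{2\pi i P(n)}=0$ for every real polynomial $P$ of degree at most $d$. Minimal sets and MMA: a nonempty subset $K\subseteq X$ is minimal if for every $x\in K$ the closure of $\{f^n x: n\geq 0\}$ equals $K$. For a minimal $K$, a point $x\in X$ is mean attracted to $K$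 if for every $\epsilon>0$ there is a point $z=z_{\epsilon,x}\in K$ with $\limsup_{N\to\infty}\frac1N\sum_{n=1}^N d(f^n x,f^n z)<\epsilon$. $\mathrm{Basin}(K)$ is the set of all points mean attracted to $K$. The map $f$ is minimal mean attractable (MMA) if $X=\bigcup_K \mathrm{Basin}(K)$, where $K$ ranges over all minimal subsets of $X$. Quasi-discrete spectrum: let $K\subseteq X$ be minimal. Let $\Phi:C(K)\to C(K)$, $\Phi\phi=\phi\circ f$, be the Koopman operator, let $G=\{g\in C(K): |g|=1\}$, an Abelian group under multiplication, and let $\Lambda:G\to G$ be the homomorphism $\Lambda g=(\Phi g)\cdot\overline{g}$. For $n\geq 0$ put $G_n=\ker(\Lambda^n)$, so that $\{1\}=G_0\subseteq G_1\subseteq G_2\subseteq\cdots$. Elements of $G_n$ are called unimodular quasi-eigenvectors of order $n-1$. The system $f:K\to K$ is QDS if the complex linear span of $\bigcup_{n\geq 0}G_n$ is dense in $C(K)$. For an integer $k\geq 0$, it is QDS$(k)$ if it is QDS and $k+1$ is the smallest $n\in\mathbb{N}$ such that $\bigcup_{j\geq 0}G_j=G_n$. MMA and MQDS$(d)$: $f$ is MMA and, for every minimal set $K\subseteq X$, $f:K\to K$ is QDS$(k)$ for some $k\leq d$ ($k$ may depend on $K$). *)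

(* Defs.v *)
From HB Require Import structures.
From mathcomp Require Import all_boot all_order all_algebra.
From mathcomp Require Import complex.
From mathcomp Require Import all_classical all_reals all_analysis.

Set Implicit Arguments.
Unset Strict Implicit.
Unset Printing Implicit Defensive.

Import Order.TTheory GRing.Theory Num.Theory.
Import numFieldNormedType.Exports.
Import ComplexField.Normc.

Local Open Scope classical_set_scope.
Local Open Scope ring_scope.
Local Open Scope complex_scope.

(* The complex numbers are [R[i]] for [R : realType]; the regular algebra
   [R[i]^o] is the copy of [R[i]] that carries the norm topology.  Sequences
   indexed by N = {1, 2, ...} are functions on [nat] whose value at [0] is
   never used. *)

Definition mean (F : numFieldType) (u : nat -> F) (N : nat) : F :=
  N%:R^-1 * \sum_(1 <= n < N.+1) u n.

Section OscillatingSequences.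
Variable R : realType.
Implicit Types c : nat -> R[i].

Definition cvg_to_zero c : Prop := c @ \oo --> (0 : R[i]^o).

Definition expi (t : R) : R[i] := cos t +i* sin t.

Definition standing_assumptions c : Prop :=
  cvg_to_zero (mean c) /\
  exists C lambda : R, [/\ 0 < C, 1 < lambda &
    forall N : nat, (1 <= N)%N ->
      mean (fun n => normc (c n) `^ lambda) N <= C].

Definition oscillating c : Prop :=
  forall theta : R, 0 <= theta < 1 ->
    cvg_to_zero (mean (fun n => c n * expi (2 * pi * n%:R * theta))).

(* [size P <= d.+1] says that [P] has degree at most [d].  Only orders
   [d >= 1] are meaningful. *)
Definition oscillating_of_order (d : nat) c : Prop :=
  if (d <= 1)%N then oscillating c
  else forall P : {poly R}, (size P <= d.+1)%N ->
    cvg_to_zero (mean (fun n => c n * expi (2 * pi * P.[n%:R]))).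

End OscillatingSequences.

Section MinimalMeanAttractable.
Variables (R : realType) (X : metricType R) (f : X -> X).

Definition orbit (x : X) : set X := range (fun n => iter n f x).

Definition minimal_set (K : set X) : Prop :=
  K !=set0 /\ forall x, K x -> closure (orbit x) = K.

Definition mean_attracted (K : set X) (x : X) : Prop :=
  forall eps : R, 0 < eps -> exists2 z, K z &
    (limn_esup (fun N =>
       (mean (fun n => mdist (iter n f x) (iter n f z)) N)%:E) < eps%:E)%E.

Definition basin (K : set X) : set X := [set x | mean_attracted K x].

Definition MMA : Prop := [set: X] = \bigcup_(K in minimal_set) basin K.

Lemma minimal_set_stable (K : set X) : minimal_set K -> set_fun K K f.
Proof.
move=> [_ Kmin] x Kx; rewrite -(Kmin x Kx).
by apply: subset_closure; exists 1%N.
Qed.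

Definition minimal_restriction (K : set X) (Kmin : minimal_set K) : K -> K :=
  fun x => SigSub (mem_set (minimal_set_stable Kmin (set_valP x))).

End MinimalMeanAttractable.

Section QuasiDiscreteSpectrum.
Variables (R : realType) (T : topologicalType) (f : T -> T).
Implicit Types g h phi : T -> R[i].

Definition cont_fun : set (T -> R[i]) :=
  [set phi | continuous (phi : T -> R[i]^o)].

Definition koopman phi : T -> R[i] := phi \o f.

Definition unimodular : set (T -> R[i]) :=
  [set g | cont_fun g /\ forall x, `|g x| = 1].

Definition Lambda g : T -> R[i] := fun x => koopman g x * (g x)^*.

Definition quasi_eigen (n : nat) : set (T -> R[i]) :=
  [set g | unimodular g /\ iter n Lambda g = cst 1].

Definition all_quasi_eigen : set (T -> R[i]) := \bigcup_n quasi_eigen n.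

Definition linear_span (A : set (T -> R[i])) : set (T -> R[i]) :=
  [set h | exists (m : nat) (a : 'I_m -> R[i]) (g : 'I_m -> T -> R[i]),
    (forall i, A (g i)) /\ h = (fun x => \sum_(i < m) a i * g i x)].

(* Density in the space of continuous functions for the maximum norm; [T] is
   meant to be compact. *)
Definition sup_dense (A : set (T -> R[i])) : Prop :=
  forall phi, cont_fun phi -> forall eps : R, 0 < eps ->
    exists2 h, A h & forall x, normc (phi x - h x) < eps.

Definition QDS : Prop := sup_dense (linear_span all_quasi_eigen).

Definition QDS_order (k : nat) : Prop :=
  [/\ QDS, all_quasi_eigen = quasi_eigen k.+1 &
      forall n : nat, (1 <= n)%N -> all_quasi_eigen = quasi_eigen n ->
        (k.+1 <= n)%N].

End QuasiDiscreteSpectrum.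

Definition MQDS (R : realType) (X : metricType R) (f : X -> X) (d : nat) :
    Prop :=
  forall (K : set X) (Kmin : minimal_set f K),
    exists2 k : nat, (k <= d)%N & QDS_order R (minimal_restriction Kmin) k.

Definition linearly_disjoint (R : realType) (X : metricType R)
    (c : nat -> R[i]) (f : X -> X) : Prop :=
  forall phi : X -> R[i], cont_fun phi -> forall x : X,
    cvg_to_zero (mean (fun n => c n * phi (iter n f x))).

(* Main.v *)
(** Let [x] be mean attracted to the minimal set [K]. Since [phi] is Lipschitz up
    to an arbitrarily small error and [c] is uniformly integrable in mean, [x] can
    be replaced by some [z] in [K] at an arbitrarily small cost in the averages of
    [c n * phi (f^n x)]. On [K], [phi] is uniformly close to a linear combination
    of quasi-eigenvectors [g] of order at most [d]. The multiplicative difference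
    of the sequence [g (f^n z)] is [(Lambda g) (f^n z)], and [Lambda^(d+1) g = 1],
    so Newton's forward difference formula gives [g (f^n z) = expi (2 * pi * P n)]
    with [P n = \sum_(j <= d) t_j * 'C(n, j)], a polynomial of degree at most [d];
    oscillation of order [d] then kills the averages of [c n * g (f^n z)]. *)

Require Import Defs.
From HB Require Import structures.
From mathcomp Require Import all_boot all_order all_algebra.
From mathcomp Require Import complex ring lra.
From mathcomp Require Import all_classical all_reals all_analysis.

Set Implicit Arguments.
Unset Strict Implicit.
Unset Printing Implicit Defensive.

Import numFieldNormedType.Exports.
Import Order.TTheory GRing.Theory Num.Theory.
Import ComplexField.Normc.
Local Open Scope classical_set_scope.
Local Open Scope ring_scope.
Local Open Scope complex_scope.

(** * Null sequences in [R[i]] and Cesàro means *)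

Section NormcAndMeans.
Variable R : realType.
Implicit Types (u v c : nat -> R[i]) (a b : nat -> R).

Lemma complex_normE (z : R[i]) : `|z| = (normc z)%:C.
Proof. by []. Qed.

Lemma normc_ge0 (z : R[i]) : 0 <= normc z.
Proof. by case: z => x y; exact: sqrtr_ge0. Qed.

Lemma normc_sum (I : Type) (r : seq I) (F : I -> R[i]) :
  normc (\sum_(i <- r) F i) <= \sum_(i <- r) normc (F i).
Proof.
elim: r => [|i r IH]; first by rewrite !big_nil normc0.
by rewrite !big_cons (le_trans (le_normcD _ _))// lerD2l.
Qed.

Lemma cvg_to_zeroP u :
  cvg_to_zero u <->
  forall e : R, 0 < e -> \forall n \near \oo, normc (u n) < e.
Proof.
split=> [/(cvgr0Pnorm_lt (V := R[i]^o)) u0 e e0|u0].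
  have e0' : (0 : R[i]) < e%:C by rewrite ltcR.
  by near=> n; rewrite -ltcR; near: n; exact: u0 _ e0'.
(* Positive elements of [R[i]] are real, so real radii suffice. *)
apply/(cvgr0Pnorm_lt (V := R[i]^o)) => -[e e'] /= /andP[/eqP e'0 e0].
have {}e'0 : e' = 0 by rewrite e'0.
rewrite e'0; near=> n; rewrite complex_normE ltcR; near: n; exact: u0.
Unshelve. all: end_near. Qed.

Lemma cvg_to_zeroD u v :
  cvg_to_zero u -> cvg_to_zero v -> cvg_to_zero (fun n => u n + v n).
Proof.
move=> /cvg_to_zeroP u0 /cvg_to_zeroP v0; apply/cvg_to_zeroP => e e0.
have e20 : 0 < e / 2 by rewrite divr_gt0.
near=> n; rewrite (le_lt_trans (le_normcD _ _))// (splitr e) ltrD//.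
- by near: n; exact: u0.
- by near: n; exact: v0.
Unshelve. all: end_near. Qed.

Lemma cvg_to_zeroZ (k : R[i]) u :
  cvg_to_zero u -> cvg_to_zero (fun n => k * u n).
Proof.
move=> /cvg_to_zeroP u0; apply/cvg_to_zeroP => e e0.
have k0 : 0 < normc k + 1 by rewrite ltr_wpDl ?normc_ge0.
have e20 : 0 < e / (normc k + 1) by rewrite divr_gt0.
near=> n; rewrite normcM.
have : normc (u n) < e / (normc k + 1) by near: n; exact: u0.
rewrite ltr_pdivlMr// mulrC; apply: le_lt_trans.
by rewrite ler_wpM2r ?normc_ge0// lerDl.
Unshelve. all: end_near. Qed.

Lemma cvg_to_zero_sum (I : Type) (r : seq I) (F : I -> nat -> R[i]) :
  (forall i, cvg_to_zero (F i)) ->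
  cvg_to_zero (fun n => \sum_(i <- r) F i n).
Proof.
move=> F0; elim: r => [|i r IH].
  under eq_fun do rewrite big_nil.
  exact: (cvg_cst (0 : R[i]^o)).
under eq_fun do rewrite big_cons.
exact: cvg_to_zeroD.
Qed.

Lemma eq_mean (F : numFieldType) (s t : nat -> F) : s =1 t -> mean s =1 mean t.
Proof. by move=> st N; rewrite /mean; under eq_bigr do rewrite st. Qed.

Lemma meanD (F : numFieldType) (s t : nat -> F) N :
  mean (fun n => s n + t n) N = mean s N + mean t N.
Proof. by rewrite /mean big_split mulrDr. Qed.

Lemma meanZ (F : numFieldType) (k : F) (s : nat -> F) N :
  mean (fun n => k * s n) N = k * mean s N.
Proof. by rewrite /mean -mulr_sumr mulrCA. Qed.

Lemma mean_cst (F : numFieldType) (k : F) N : (0 < N)%N -> mean (fun=> k) N = k.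
Proof.
move=> N0; rewrite /mean big_const_nat iter_addr_0 subn1/= -[k *+ N]mulr_natl.
by rewrite mulKf// pnatr_eq0 -lt0n.
Qed.

Lemma ler_mean (F : numFieldType) (s t : nat -> F) N :
  (forall n, s n <= t n) -> mean s N <= mean t N.
Proof. by move=> st; rewrite /mean ler_wpM2l ?invr_ge0// ler_sum. Qed.

Lemma normc_mean u N : normc (mean u N) <= mean (fun n => normc (u n)) N.
Proof.
rewrite /mean normcM ler_pM ?normc_ge0//; last exact: normc_sum.
by rewrite normcV -(rmorph_nat (real_complex R)) /= expr0n addr0 sqrtr_sqr ger0_norm.
Qed.

(* Superlinear growth of [x ^ lambda] makes [c] uniformly integrable. *)
Lemma powR_superlinear (lambda e : R) : 1 < lambda -> 0 < e ->
  exists2 T : R, 0 < T & forall x, 0 <= x -> x <= T + e * x `^ lambda.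
Proof.
move=> l1 e0; have l10 : 0 < lambda - 1 by rewrite subr_gt0.
(* Chosen so that [T] to the power [lambda - 1] is [1 / e]: beyond [T], the term in [e] alone
   dominates [x]. *)
pose T := (e^-1) `^ (lambda - 1)^-1.
have T0 : 0 < T by apply: powR_gt0; rewrite invr_gt0.
exists T => // x x0; have [xT|Tx] := leP x T.
  by rewrite (le_trans xT)// lerDl mulr_ge0 ?powR_ge0 ?ltW.
rewrite (@le_trans _ _ (e * x `^ lambda))//; last by rewrite lerDr ltW.
rewrite -mulr_powRB1// ?(lt_trans _ l1)// mulrCA ler_peMr//.
rewrite mulrC -ler_pdivrMr// mul1r.
have -> : e^-1 = T `^ (lambda - 1).
  by rewrite -powRrM mulVf ?gt_eqF// powRr1// invr_ge0 ltW.
by rewrite ge0_ler_powR// ?nnegrE ltW.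
Qed.

(** Bounds [|c n| * a n] by [T * a n], whose mean is small with that of [a], plus
    [h * |c n| ^ lambda * a n], controlled by [a n <= B] and the moment bound. Hence [delta] is
    uniform in [a] and [N]. *)
Lemma mean_weighted_small c (B e : R) :
  standing_assumptions c -> 0 < B -> 0 < e ->
  exists2 delta : R, 0 < delta & forall a N, (1 <= N)%N ->
    (forall n, 0 <= a n <= B) -> mean a N <= delta ->
    mean (fun n => normc (c n) * a n) N <= e.
Proof.
move=> [_ [C [lambda [C0 l1 cC]]]] B0 e0.
(* Makes [h * B * C] equal to [e / 2]; the choice of [delta] below gives the other half. *)
pose h := e / (2 * (B * C)).
have BC0 : 0 < 2 * (B * C) by rewrite !mulr_gt0.
have h0 : 0 < h by rewrite divr_gt0.
have [T T0 Tlambda] := powR_superlinear l1 h0.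
exists (e / (2 * T)); first by rewrite divr_gt0// mulr_gt0.
move=> a N N1 aB aN.
pose b := fun n => normc (c n) `^ lambda.
apply: (@le_trans _ _ (T * mean a N + h * B * mean b N)).
  rewrite -!meanZ -meanD; apply: ler_mean => n.
  have /andP[a0 aBn] := aB n.
  apply: le_trans (ler_wpM2r a0 (Tlambda _ (normc_ge0 (c n)))) _.
  rewrite mulrDl lerD2l mulrAC ler_wpM2r ?powR_ge0//.
  by rewrite ler_wpM2l// ltW.
have -> : e = T * (e / (2 * T)) + h * B * C.
  rewrite /h; field; by rewrite !gt_eqF.
apply: lerD; apply: ler_wpM2l => //; first exact: ltW.
  by rewrite mulr_ge0// ltW.
exact: cC.
Qed.

(** Uniform integrability of [c] applied to [|u n - v n|]; this is why [B] is fixed before [delta].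
    It serves both to change the function and to change the orbit. *)
Lemma cvg_mean_approx c u (B : R) : standing_assumptions c -> 0 < B ->
  (forall delta : R, 0 < delta -> exists v,
    [/\ forall n, normc (u n - v n) <= B,
        \forall N \near \oo, mean (fun n => normc (u n - v n)) N <= delta &
        cvg_to_zero (mean (fun n => c n * v n))]) ->
  cvg_to_zero (mean (fun n => c n * u n)).
Proof.
move=> cS B0 uv; apply/cvg_to_zeroP => e e0.
have e20 : 0 < e / 2 by rewrite divr_gt0.
have [delta delta0 small] := mean_weighted_small cS B0 e20.
have [v [uvB uvd /cvg_to_zeroP v0]] := uv _ delta0.
near=> N.
have N1 : (1 <= N)%N by near: N; exact: nbhs_infty_ge.
have -> : mean (fun n => c n * u n) N =
    mean (fun n => c n * (u n - v n)) N + mean (fun n => c n * v n) N.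
  by rewrite -meanD; apply: eq_mean => n; rewrite mulrBr subrK.
rewrite (le_lt_trans (le_normcD _ _))// (splitr e) ler_ltD//; last first.
  by near: N; exact: v0.
apply: le_trans (normc_mean _ _) _.
rewrite (eq_mean (fun n => normcM _ _)); apply: small => //.
  by move=> n; rewrite normc_ge0 uvB.
by near: N; exact: uvd.
Unshelve. all: end_near. Qed.

End NormcAndMeans.

(** * Angles of points on the unit circle *)

Section Expi.
Variable R : realType.

Lemma expi0 : expi (0 : R) = 1.
Proof. by rewrite /expi cos0 sin0. Qed.

Lemma expiD (s t : R) : expi (s + t) = expi s * expi t.
Proof. by rewrite /expi cosD sinD; simpc; rewrite addrC [in X in _ +i* X]addrC. Qed.

Lemma unimodular_angle (z : R[i]) : `|z| = 1 ->
  exists2 t : R, 0 <= t < 1 & z = expi (2 * pi * t).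
Proof.
case: z => x y; rewrite complex_normE => -[] /= xy1.
have {}xy1 : x ^+ 2 + y ^+ 2 = 1.
  by rewrite -[LHS]sqr_sqrtr ?addr_ge0 ?sqr_ge0// xy1 expr1n.
have x1 : -1 <= x <= 1.
  have y0 := sqr_ge0 y; apply/andP; split; nra.
have [a0 ca] := acos_def x1.
have sa := sin_acos x1.
have pi0 := pi_gt0 R; have pi2 : 0 < 2 * pi :> R by rewrite mulr_gt0.
have sy : Num.sqrt (1 - x ^+ 2) = `|y| by rewrite -sqrtr_sqr -xy1 addrC addKr.
have [y0|y0] := leP 0 y.
  exists (acos x / (2 * pi)).
    have /andP[? ?] := a0; apply/andP; split; first by rewrite divr_ge0// ltW.
    rewrite ltr_pdivrMr//; lra.
  by rewrite mulrC divfK ?gt_eqF// /expi ca sa sy ger0_norm.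
(* In the lower half-plane the angle is [2 * pi - acos x]; [y < 0] forces [x < 1], so [acos x > 0]
   and the parameter stays below 1. *)
exists (1 - acos x / (2 * pi)).
  have xlt1 : x < 1 by nra.
  have a_gt0 : 0 < acos x by apply: acos_gt0; case/andP: x1 => -> _.
  have /andP[_ a_lepi] := a0.
  rewrite subr_ge0 ltrBlDr ltrDl divr_gt0// andbT.
  by rewrite ler_pdivrMr// mul1r (le_trans a_lepi)// ler_peMl ?ler1n// ltW.
have -> : 2 * pi * (1 - acos x / (2 * pi)) = - acos x + pi + pi.
  by rewrite mulrBr mulr1 mulrCA divff ?gt_eqF// mulr1 mulr_natl mulr2n addrC addrA.
by rewrite /expi !cosDpi !sinDpi !opprK cosN sinN ca sa sy ltr0_norm// opprK.
Qed.

End Expi.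

(** * Binomial coefficients as polynomials *)

Section BinomialPolynomial.
Variable R : realType.

(** The binomial coefficient [X (X - 1) ... (X - j + 1) / j!] as a polynomial in its upper
    argument. *)
Definition binpoly (j : nat) : {poly R} :=
  (j`!%:R)^-1 *: \prod_(i < j) ('X - i%:R%:P).

Lemma size_binpoly j : (size (binpoly j) <= j.+1)%N.
Proof.
rewrite (leq_trans (size_scale_leq _ _))//.
by rewrite size_prod_XsubC /index_enum -enumT size_enum_ord.
Qed.

Lemma horner_binpoly j n : (binpoly j).[n%:R] = 'C(n, j)%:R.
Proof.
have fallingE : (\prod_(i < j) ('X - i%:R%:P) : {poly R}).[n%:R] = (n ^_ j)%:R.
  rewrite horner_prod; elim: j => [|j IH]; first by rewrite big_ord0 ffactn0.
  rewrite big_ord_recr /= IH ffactnSr hornerXsubC natrM.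
  (* Truncated and ring subtraction agree for [j <= n]; otherwise the factor [n ^_ j] vanishes. *)
  have [jn|nj] := leqP j n; first by rewrite natrB.
  by rewrite ffact_small// !mul0r.
rewrite hornerZ fallingE -bin_ffact natrM mulrC mulfK//.
Qed.

End BinomialPolynomial.

(** * Quasi-eigenvectors along an orbit *)

Section QuasiEigenOrbits.
Variables (R : realType) (T : topologicalType) (f : T -> T).
Implicit Types g : T -> R[i].

(** Conjugation inverts unimodular numbers, so [Lambda] is a multiplicative difference. *)
Lemma LambdaE g x : `|g x| = 1 -> g (f x) = g x * Lambda f g x.
Proof.
by move=> g1; rewrite /Lambda /koopman/= mulrCA -sqr_normc g1 expr1n mulr1.
Qed.

Lemma Lambda_norm1 g :
  (forall x, `|g x| = 1) -> forall x, `|Lambda f g x| = 1.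
Proof. by move=> g1 x; rewrite /Lambda /koopman normrM normcJ !g1 mulr1. Qed.

Lemma Lambda_cst1 : Lambda f (cst 1 : T -> R[i]) = cst 1.
Proof. by apply/funext => x; rewrite /Lambda /koopman /= rmorph1 mulr1. Qed.

Lemma quasi_eigen_le (m n : nat) : (m <= n)%N ->
  quasi_eigen f m `<=` (quasi_eigen f n : set (T -> R[i])).
Proof.
move=> /subnK <- g [gU g1]; split=> //; rewrite iterD g1.
by elim: (n - m)%N => //= k ->; exact: Lambda_cst1.
Qed.

(** Newton's formula by induction on [m], applied to [Lambda f g]. The range of [t] is recorded
    because order 1 oscillation only concerns angles in [[0, 1)]. *)
Lemma quasi_eigen_orbit (m : nat) g (z : T) :
  (forall x, `|g x| = 1) -> iter m (Lambda f) g = cst 1 ->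
  exists2 t : nat -> R, forall j, 0 <= t j < 1 &
    forall n, g (iter n f z) =
      expi (2 * pi * \sum_(j < m) t j * 'C(n, j)%:R).
Proof.
elim: m g => [|m IH] g g1 gm.
  exists (fun=> 0); first by move=> j; rewrite lexx ltr01.
  by move=> n; rewrite big_ord0 mulr0 expi0 (_ : g = cst 1).
have [t t01 tE] := IH _ (Lambda_norm1 g1) (etrans (esym (iterSr _ _ _)) gm).
have [s s01 sE] := unimodular_angle (g1 z).
(* The constant term is the angle of [g z]; the coefficients of [Lambda f g] move up one degree. *)
exists (fun j => if j is i.+1 then t i else s); first by case.
elim=> [|n IHn].
  rewrite big_ord_recl big1 ?bin0 ?mulr1 ?addr0//.
  by move=> j _; rewrite bin0n mulr0.
(* The two exponents add up by Pascal's rule. *)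
rewrite iterS LambdaE// IHn tE -expiD -mulrDr !big_ord_recl !bin0 -addrA.
rewrite -big_split/=; congr (expi (_ * (_ + _))); apply: eq_bigr => j _.
by rewrite /bump /= add1n binS natrD mulrDr.
Qed.

End QuasiEigenOrbits.

Lemma oscillating_quasi_eigen (R : realType) (T : topologicalType) (f : T -> T)
    (d : nat) (c : nat -> R[i]) (g : T -> R[i]) (z : T) :
  (1 <= d)%N -> oscillating_of_order d c -> quasi_eigen f d.+1 g ->
  cvg_to_zero (mean (fun n => c n * g (iter n f z))).
Proof.
move=> d1 cosc [[_ g1] gm]; have [t t01 tE] := quasi_eigen_orbit z g1 gm.
under eq_fun do rewrite tE.
move: cosc; rewrite /oscillating_of_order; case: ifPn => [d_le1|_] cosc.
  (* For order 1, the constant phase [t 0] factors out and [t 1] plays the role of [theta]. *)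
  have {d1 d_le1} -> : d = 1%N by apply/eqP; rewrite eqn_leq d_le1.
  pose w n := c n * expi (2 * pi * n%:R * t 1%N).
  have -> : mean (fun n => c n * expi
      (2 * pi * \sum_(j < 2) t j * 'C(n, j)%:R)) =
      fun N => expi (2 * pi * t 0%N) * mean w N.
    apply/funext => N; rewrite -meanZ; apply: eq_mean => n.
    rewrite /w mulrCA -expiD big_ord_recl big_ord1/= bin0 bin1.
    by congr (_ * expi _); ring.
  by apply: cvg_to_zeroZ; exact: cosc.
pose P := \sum_(j < d.+1) t j *: binpoly R j.
have sP : (size P <= d.+1)%N.
  rewrite (leq_trans (size_sum _ _ _))//; apply/bigmax_leqP => j _.
  rewrite (leq_trans (size_scale_leq _ _))//.
  by rewrite (leq_trans (size_binpoly _ _)).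
have PE n : P.[n%:R] = \sum_(j < d.+1) t j * 'C(n, j)%:R.
  by rewrite horner_sum; apply: eq_bigr => j _; rewrite hornerZ horner_binpoly.
by under eq_fun do rewrite -PE; exact: cosc.
Qed.

Lemma oscillating_linear_span (R : realType) (T : topologicalType) (f : T -> T)
    (d : nat) (c : nat -> R[i]) (h : T -> R[i]) (z : T) :
  (1 <= d)%N -> oscillating_of_order d c ->
  linear_span (quasi_eigen f d.+1) h ->
  cvg_to_zero (mean (fun n => c n * h (iter n f z))).
Proof.
move=> d1 cosc [m [a [g [gq ->]]]].
have -> : mean (fun n => c n * \sum_(i < m) a i * g i (iter n f z)) =
    fun N => \sum_(i < m) a i * mean (fun n => c n * g i (iter n f z)) N.
  apply/funext => N; under [RHS]eq_bigr do rewrite -meanZ.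
  rewrite /mean -mulr_sumr exchange_big/=; congr (_ * _).
  by apply: eq_bigr => n _; rewrite mulr_sumr; under eq_bigr do rewrite mulrCA.
apply: cvg_to_zero_sum => i; apply: cvg_to_zeroZ.
exact: oscillating_quasi_eigen d1 cosc (gq i).
Qed.

(** * Uniform estimates from compactness *)

Section MetricLemmas.
Variables (R : realType) (X : metricType R).
Hypothesis Xc : compact [set: X].
Variable phi : X -> R[i].
Hypothesis phic : cont_fun phi.

Lemma cont_fun_near (x : X) (e : R) : 0 < e ->
  \forall y \near x, normc (phi x - phi y) < e.
Proof.
move=> e0; have e0' : (0 : R[i]) < e%:C by rewrite ltcR.
have phix := (cvgrPdist_lt (V := R[i]^o) phi (phi x)).1 (@phic x) _ e0'.
by near=> y; rewrite -ltcR; near: y; exact: phix.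
Unshelve. all: end_near. Qed.

Lemma compact_cont_fun_bounded :
  exists2 B : R, 0 < B & forall x, normc (phi x) <= B.
Proof.
(* A bound valid near each point for all large [n] holds everywhere for a single [n], by
   compactness. *)
have : \forall n \near \oo, [set: X] `<=` (fun x => normc (phi x) <= n%:R).
  apply: (compact_near_coveringP _).1 => // x _.
  exists ([set y | normc (phi x - phi y) < 1],
          [set n : nat | normc (phi x) + 1 <= n%:R]) => /=.
    split; first exact: cont_fun_near.
    by near=> n; near: n; exact: nbhs_infty_ger.
  move=> [y n] /= [xy xn]; apply: le_trans xn.
  rewrite -[phi y](subrK (phi x)) addrC.
  rewrite (le_trans (le_normcD _ _))// lerD2l -normcN opprB ltW//.
move=> [n _ /(_ n (leqnn n)) nB]; exists n.+1%:R => // x.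
by rewrite (le_trans (nB x I))// ler_nat.
Unshelve. all: end_near. Qed.

(** Nearby points are handled by continuity, which costs [e]; for points at distance bounded below,
    a large slope absorbs the bound [2 * B]. *)
Lemma compact_cont_fun_lipschitz_up_to (e : R) : 0 < e ->
  exists2 M : R, 0 < M &
    forall x y, normc (phi x - phi y) <= e + M * mdist x y.
Proof.
move=> e0; have [B B0 phiB] := compact_cont_fun_bounded.
have : \forall n \near \oo, [set: X] `<=` (fun x => forall y,
    normc (phi x - phi y) <= e + n%:R * mdist x y).
  apply: (compact_near_coveringP _).1 => // x _.
  have e20 : 0 < e / 2 by rewrite divr_gt0.
  have /metricType_numDomainType.nbhs_mdistP[r /= r0 xr] := cont_fun_near x e20.
  (* Radius [r / 2] keeps both points in the [r]-ball at [x] when they are close; slope [4 * B / r]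
     gives [2 * B] at distance [r / 2]. *)
  exists ([set y | mdist x y < r / 2], [set n : nat | 4 * B / r <= n%:R]) => /=.
    split; last by near=> n; near: n; exact: nbhs_infty_ger.
    apply/metricType_numDomainType.nbhs_mdistP.
    by exists (r / 2); rewrite //= divr_gt0.
  move=> [x' n] /= [xx' Bn] y.
  have [x'y|x'y] := ltP (mdist x' y) (r / 2).
    have -> : phi x' - phi y = - (phi x - phi x') + (phi x - phi y).
      by rewrite opprB addrA subrK.
    rewrite (le_trans (le_normcD _ _))// normcN.
    rewrite (@le_trans _ _ e)//; last by rewrite lerDl mulr_ge0// mdist_ge0.
    rewrite (splitr e) lerD// ltW//; apply: xr => /=.
      rewrite (lt_trans xx')// ltr_pdivrMr//; lra.
    by rewrite (le_lt_trans (metric_triangle _ x' _))// (splitr r) ltrD.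
  rewrite (le_trans (le_normcD _ _))// normcN.
  rewrite (@le_trans _ _ (4 * B / r * (r / 2)))//.
    have -> : 4 * B / r * (r / 2) = B + B by field; rewrite gt_eqF.
    exact: lerD.
  rewrite (@le_trans _ _ (n%:R * mdist x' y))//; last by rewrite lerDr ltW.
  by rewrite ler_pM// ?divr_ge0 ?mulr_ge0// ltW.
move=> [n _ /(_ n.+1 (leqnSn n)) nM]; exists n.+1%:R => // x y.
exact: nM.
Unshelve. all: end_near. Qed.

End MetricLemmas.

(** * Reduction to minimal sets and conclusion *)

Lemma iter_minimal_restriction (R : realType) (X : metricType R) (f : X -> X)
    (K : set X) (Kmin : minimal_set f K) (z : K) n :
  set_val (iter n (minimal_restriction Kmin) z) = iter n f (set_val z).
Proof. by elim: n => //= n <-. Qed.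

(** The upper limit is an infimum of suprema over neighbourhoods of infinity, so one of these
    suprema is below [e]. *)
Lemma limn_esup_lt_near (R : realType) (u : nat -> R) (e : R) :
  (limn_esup (fun n => (u n)%:E) < e%:E)%E -> \forall n \near \oo, u n < e.
Proof.
move=> /ereal_inf_lt[_ [V Voo <-] Ve]; apply: filterS Voo => n Vn.
rewrite -lte_fin; apply: le_lt_trans Ve.
by apply: ereal_sup_ubound; exists n.
Qed.

Theorem theorem3 (R : realType) (d : nat) (X : metricType R) (f : X -> X)
    (c : nat -> R[i]) :
  (1 <= d)%N ->
  compact [set: X] ->
  continuous f ->
  MMA f ->
  MQDS f d ->
  standing_assumptions c ->
  oscillating_of_order d c ->
  linearly_disjoint c f.
Proof.
move=> d1 Xc _ fMMA fMQDS cS cosc phi phic x.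
have [K Kmin xK] : (\bigcup_(K in minimal_set f) basin f K) x by rewrite -fMMA.
have [B B0 phiB] := compact_cont_fun_bounded Xc phic.
have onK z : K z -> cvg_to_zero (mean (fun n => c n * phi (iter n f z))).
  move=> Kz; pose zK : K := SigSub (mem_set Kz).
  have [k kd [Kqds KG _]] := fMQDS _ Kmin.
  apply: (cvg_mean_approx (B := 1) cS) => // delta delta0.
  have phiKc : cont_fun (phi \o (set_val : K -> X)).
    by move=> y; apply: continuous_comp; [exact: initial_continuous|exact: phic].
  (* The 1 provides the bound [B := 1] independent of [delta]; the other argument makes the mean
     error small. *)
  have m0 : 0 < Num.min 1 delta by rewrite lt_min ltr01.
  have [h hspan hphi] := Kqds _ phiKc _ m0.
  have hE n : normc (phi (iter n f z) -
      h (iter n (minimal_restriction Kmin) zK)) < Num.min 1 delta.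
    by rewrite -[z]/(set_val zK) -(iter_minimal_restriction Kmin); exact: hphi.
  exists (fun n => h (iter n (minimal_restriction Kmin) zK)); split.
  - by move=> n; have := hE n; rewrite lt_min => /andP[/ltW].
  - near=> N; rewrite -[leRHS](@mean_cst _ _ N); last first.
      by near: N; exact: nbhs_infty_gt.
    by apply: ler_mean => n; have := hE n; rewrite lt_min => /andP[_ /ltW].
  - apply: oscillating_linear_span d1 cosc _.
    have [m [a [g [gq ->]]]] := hspan; exists m, a, g; split=> // i.
    (* All quasi-eigenvectors lie in [G_(k+1)], hence in [G_(d+1)] since [k <= d]. *)
    by apply: (@quasi_eigen_le _ _ _ k.+1); rewrite -?KG.
apply: (cvg_mean_approx (B := B + B) cS) => [|delta delta0].
  exact: addr_gt0.
have delta20 : 0 < delta / 2 by rewrite divr_gt0.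
have [M M0 phiM] := compact_cont_fun_lipschitz_up_to Xc phic delta20.
(* The mean error is at most [delta / 2] plus [M] times the mean distance between the orbits. *)
have dM0 : 0 < delta / 2 / M by rewrite divr_gt0.
have [z Kz /limn_esup_lt_near xz] := xK _ dM0.
exists (fun n => phi (iter n f z)); split; last exact: onK.
  by move=> n; rewrite (le_trans (le_normcD _ _))// normcN lerD.
near=> N; apply: le_trans (ler_mean _ (fun n => phiM _ _)) _.
rewrite meanD mean_cst; last by near: N; exact: nbhs_infty_gt.
rewrite meanZ [leRHS]splitr lerD2l mulrC -ler_pdivlMr//; apply: ltW.
by near: N.
Unshelve. all: end_near. Qed.
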